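(* Let $p$ be an odd prime and let $G$ be a group of order $p^5$ which is not $p$-central and such that $|\Phi(G)|=p^3$. Then the transiso graph $\Gamma_p(G)$ is not complete.
   Context: $\Phi(G)$ denotes the Frattini subgroup of $G$. A finite $p$-group is not $p$-central if it has a subgroup of order $p$ not contained in its center. For a finite group $G$ and a subgroup $H\le G$, a normalized right transversal (NRT) of $H$ in $G$ is a subset $S\subseteq G$ with $1\in S$ containing exactly one element of each right coset of $H$ in $G$; $\mathcal{T}(G,H)$ denotes the set of all NRTs of $H$ in $G$. An NRT $S$ carries the induced binary operation $\circ$ defined by $\{x\circ y\}=S\cap Hxy$ for $x,y\in S$, which makes $S$ a right loop with identity $1$. Two NRTs $S,T$ (possibly of different subgroups) are isomorphic, $S\cong T$, if there is a bijection $S\to T$ preserving the induced operations. For a divisor $d$ of $|G|$, the transiso graph $\Gamma_d(G)$ is the simple graph whose vertices are the subgroups of $G$ of order $d$, and in which two distinct vertices $H_1,H_2$ are adjacent if and only if there exist $S_i\in\mathcal{T}(G,H_i)$ $(i=1,2)$ with $S_1\cong S_2$. A graph is complete if any two distinct vertices are adjacent. *)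

(* Defs.v *)
From HB Require Import structures.
From mathcomp Require Import all_boot all_fingroup all_solvable.

Set Implicit Arguments.
Unset Strict Implicit.
Unset Printing Implicit Defensive.

Local Open Scope group_scope.

Record simpleGraph := SimpleGraph {
  vertex : finType;
  adj : vertex -> vertex -> Prop;
  adj_sym : forall u v, adj u v -> adj v u;
  adj_irrefl : forall u, ~ adj u u
}.

Definition complete_graph (A : simpleGraph) : Prop :=
  forall u v : vertex A, u != v -> adj u v.

Definition not_p_central (gT : finGroupType) (p : nat) (G : {group gT}) : Prop :=
  exists K : {group gT}, [/\ K \subset G, #|K| = p & ~~ (K \subset 'Z(G))].

(* Normalized right transversals of H in G; in MathComp, [rcosets H G] is the
   set of the cosets H :* x with x \in G. *)
Definition NRT (gT : finGroupType) (G H : {group gT}) : {set {set gT}} :=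
  [set S : {set gT} | (1 \in S) && is_transversal S (rcosets H G) G].

(* For S in [NRT G H] and x, y in S, the set S :&: H :* (x * y) is a singleton,
   whose element is the value; other values are irrelevant. *)
Definition nrt_op (gT : finGroupType) (H S : {set gT}) (x y : gT) : gT :=
  repr (S :&: H :* (x * y)).

(* Only the restriction of f to S matters. *)
Definition nrt_isog (gT rT : finGroupType) (H S : {set gT}) (K T : {set rT}) :
    Prop :=
  exists f : gT -> rT,
    [/\ {in S &, injective f}, f @: S = T
      & {in S &, forall x y, f (nrt_op H S x y) = nrt_op K T (f x) (f y)}].

Lemma nrt_op_closed (gT : finGroupType) (G H : {group gT}) (S : {set gT}) :
  S \in NRT G H -> {in S &, forall x y, nrt_op H S x y \in S}.
Proof.
rewrite inE => /andP[_ /and3P[_ /subsetP sSG /forall_inP trS]] x y Sx Sy.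
have /trS/cards1P[z Dz]: H :* (x * y) \in rcosets H G.
  by apply/rcosetsP; exists (x * y); rewrite ?groupM ?sSG.
rewrite /nrt_op Dz; have: z \in S :&: H :* (x * y) by rewrite Dz set11.
by rewrite inE => /andP[Sz _]; have:= mem_repr z (set11 z) => /set1P->.
Qed.

Lemma nrt_isog_sym (gT rT : finGroupType) (G H : {group gT}) (S : {set gT})
    (K T : {set rT}) :
  S \in NRT G H -> nrt_isog H S K T -> nrt_isog K T H S.
Proof.
move=> trS [f [injf imf fM]].
pose g u := odflt 1 [pick x in S | f x == u].
have gf x : x \in S -> g (f x) = x.
  move=> Sx; rewrite /g; case: pickP => [y /andP[Sy /eqP /injf->] // | /(_ x)].
  by rewrite /= Sx eqxx.
exists g; rewrite -imf; split.
- by move=> _ _ /imsetP[x Sx ->] /imsetP[y Sy ->]; rewrite !gf // => ->.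
- rewrite -imset_comp -[RHS]imset_id; apply: eq_in_imset => x Sx; exact: gf.
move=> _ _ /imsetP[x Sx ->] /imsetP[y Sy ->].
by rewrite !gf // imf -fM // gf // (nrt_op_closed trS).
Qed.

Section TransisoGraph.

Variables (gT : finGroupType) (G : {group gT}) (d : nat).

Definition subgroup_of_order : predArgType :=
  {H : {group gT} | (H \subset G) && (#|H| == d)}.

Definition transiso_adj (H1 H2 : subgroup_of_order) : Prop :=
  H1 != H2 /\
  exists S1 S2 : {set gT},
    [/\ S1 \in NRT G (val H1), S2 \in NRT G (val H2)
      & nrt_isog (val H1) S1 (val H2) S2].

Lemma transiso_adj_sym H1 H2 : transiso_adj H1 H2 -> transiso_adj H2 H1.
Proof.
case=> neq [S1 [S2 [trS1 trS2 iso]]]; split; first by rewrite eq_sym.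
by exists S2, S1; split=> //; apply: nrt_isog_sym trS1 iso.
Qed.

Lemma transiso_adj_irrefl H : ~ transiso_adj H H.
Proof. by case; rewrite eqxx. Qed.

Definition transiso_graph : simpleGraph :=
  SimpleGraph transiso_adj_sym transiso_adj_irrefl.

End TransisoGraph.

(* Main.v *)
Require Import Defs.
From mathcomp Require Import all_boot all_fingroup all_solvable.

(* Suppose the graph is complete. A transversal of a normal subgroup H is
   isomorphic to G / H, so any two central subgroups of order p have isomorphic
   quotients, and a transversal T of a noncentral subgroup K of order p that is
   isomorphic to G / H is associative, hence a subgroup (K has trivial core).
   Thus K has a complement M of order p^4 isomorphic to G / H for every central
   H of order p. As Phi(G) <= M, noncentral subgroups of order p avoid Phi(G).

   If Phi(G) is not cyclic then, p being odd, it contains an elementary abelian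
   E of order p^2, which is central; E <= G' since all the (G / H)' have the
   same order. As E <= Z(M), |M'| <= p, so |G'| <= p^2 and G' = E. Then
   Phi(G) <= Z(G), so |G : Z(G)| <= p^2 and |G'| <= p, a contradiction.

   If Phi(G) is cyclic, it is a maximal subgroup of M, so |M'| <= p,
   |G'| <= p^2 and G' <= Phi(Phi(G)) <= Phi(M). Hence G / Phi(M), generated by
   the images of M and K, is elementary abelian and Phi(G) <= Phi(M), but
   |Phi(M)| = |Phi(G / H)| = p^2 for H <= Phi(G). *)

Set Implicit Arguments.
Unset Strict Implicit.
Unset Printing Implicit Defensive.

Local Open Scope group_scope.

(** * Normalized right transversals and the coset map *)

Section Transversals.

Variable gT : finGroupType.
Implicit Types G H K : {group gT}.

Lemma NRT_sub G H (S : {set gT}) : S \in NRT G H -> S \subset G.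
Proof. by rewrite inE => /andP[_ /and3P[]]. Qed.

Lemma NRT_setI_rcoset G H S x :
  S \in NRT G H -> x \in G -> exists z, S :&: H :* x = [set z].
Proof.
rewrite inE => /andP[_ /and3P[_ _ /forall_inP trS]] Gx.
by apply/cards1P/trS/rcosetsP; exists x.
Qed.

Lemma NRT_rcoset_inj G H S x y :
  S \in NRT G H -> x \in S -> y \in S -> y \in H :* x -> y = x.
Proof.
move=> trS Sx Sy Hxy.
have [z Dz] := NRT_setI_rcoset trS (subsetP (NRT_sub trS) x Sx).
have: x \in S :&: H :* x by rewrite inE Sx rcoset_refl.
have: y \in S :&: H :* x by rewrite inE Sy.
by rewrite Dz !inE => /eqP-> /eqP.
Qed.

Lemma nrt_op_mem G H S x y : S \in NRT G H -> x \in S -> y \in S ->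
  nrt_op H S x y \in S :&: H :* (x * y).
Proof.
move=> trS /(subsetP (NRT_sub trS))Gx /(subsetP (NRT_sub trS))Gy.
have [z Dz] := NRT_setI_rcoset trS (groupM Gx Gy).
by rewrite /nrt_op Dz (mem_repr z) ?set11.
Qed.

Lemma nrt_opP G H S x y z : S \in NRT G H -> x \in S -> y \in S -> z \in S ->
  z \in H :* (x * y) -> nrt_op H S x y = z.
Proof.
move=> trS Sx Sy Sz Hz; have /setIP[Ss Hs] := nrt_op_mem trS Sx Sy.
by apply: (NRT_rcoset_inj trS Sz Ss); rewrite (rcoset_eqP Hz).
Qed.

Lemma coset_NRT_inj G H S :
  H <| G -> S \in NRT G H -> {in S &, injective (coset H)}.
Proof.
move=> nsHG trS x y Sx Sy; have sSG := subsetP (NRT_sub trS).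
have nHG := subsetP (normal_norm nsHG).
move=> Exy; apply: (NRT_rcoset_inj trS Sy Sx).
by apply/rcoset_kercosetP; rewrite ?nHG ?sSG.
Qed.

Lemma coset_NRT_im G H S : H <| G -> S \in NRT G H -> coset H @: S = G / H.
Proof.
move=> nsHG trS; have sSG := NRT_sub trS; have nHG := normal_norm nsHG.
rewrite quotientE morphimEsub //; apply/eqP; rewrite eqEsubset imsetS //=.
apply/subsetP=> _ /imsetP[x Gx ->]; have [z Dz] := NRT_setI_rcoset trS Gx.
have /setIP[Sz Hz]: z \in S :&: H :* x by rewrite Dz set11.
apply/imsetP; exists z => //=; apply/esym/rcoset_kercosetP=> //.
  by rewrite (subsetP nHG) ?(subsetP sSG).
by rewrite (subsetP nHG).
Qed.

Lemma coset_nrt_op G H S x y : H <| G -> S \in NRT G H -> x \in S -> y \in S ->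
  coset H (nrt_op H S x y) = coset H x * coset H y.
Proof.
move=> nsHG trS Sx Sy; have /setIP[Ss Hs] := nrt_op_mem trS Sx Sy.
have sSN := subsetP (subset_trans (NRT_sub trS) (normal_norm nsHG)).
by rewrite -morphM ?sSN //; apply/rcoset_kercosetP; rewrite ?groupM ?sSN.
Qed.

(** * Transversals isomorphic to a transversal of a normal subgroup *)

Section NormalLeft.

Variables (G H K : {group gT}) (S T : {set gT}).
Hypotheses (nsHG : H <| G) (trS : S \in NRT G H) (trT : T \in NRT G K).

(** The coset map is a multiplicative bijection from [S] onto [G / H], so its inverse composed with
    the given isomorphism transports the group law of [G / H] to [T]. *)
Lemma quotient_nrt_isog : nrt_isog H S K T ->
  exists f : coset_of H -> gT, [/\ {in G / H &, injective f}, f @: (G / H) = T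
    & {in G / H &, forall a b, f (a * b) = nrt_op K T (f a) (f b)}].
Proof.
case=> f [injf imf fM].
(* [g] inverts the coset map on [S]; the default 1 is never reached on [G / H]. *)
pose g (a : coset_of H) := odflt 1 [pick x in S | coset H x == a].
have gK x : x \in S -> g (coset H x) = x.
  move=> Sx; rewrite /g; case: pickP => [y /andP[Sy /eqP] | /(_ x)].
    exact: (coset_NRT_inj nsHG trS).
  by rewrite /= Sx eqxx.
exists (f \o g); rewrite -(coset_NRT_im nsHG trS); split.
- move=> _ _ /imsetP[x Sx ->] /imsetP[y Sy ->] /=.
  by rewrite !gK // => /injf->.
- by rewrite -imset_comp -imf; apply: eq_in_imset => x Sx /=; rewrite gK.
move=> _ _ /imsetP[x Sx ->] /imsetP[y Sy ->] /=.
have /setIP[So _] := nrt_op_mem trS Sx Sy.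
by rewrite -(coset_nrt_op nsHG trS) // !gK // fM.
Qed.

Lemma nrt_isog_normal : K <| G -> nrt_isog H S K T -> G / H \isog G / K.
Proof.
move=> nsKG /quotient_nrt_isog[f [injf imf fM]].
have Tf a : a \in G / H -> f a \in T by move=> Ga; rewrite -imf imset_f.
have cfM : {in G / H &, {morph coset K \o f : a b / a * b}}.
  by move=> a b Ga Gb; rewrite /= fM // (coset_nrt_op nsKG) ?Tf.
apply/isogP; exists (Morphism cfM).
  by apply/injmP=> a b Ga Gb /(coset_NRT_inj nsKG trT)/injf->; rewrite ?Tf.
by rewrite morphimEdom /= imset_comp imf (coset_NRT_im nsKG).
Qed.

(* T inherits associativity from G / H; comparing the action of
   x * y and of x o y on the cosets K :* z, this puts
   (x * y) * (x o y)^-1 in every conjugate of K, so that the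
   two products coincide. *)
Lemma nrt_isog_core1 : gcore K G = 1 -> nrt_isog H S K T ->
  exists M : {group gT}, [/\ M :=: T, K :&: M = 1, M \subset G & G / H \isog M].
Proof.
move=> coreK1 /quotient_nrt_isog[f [injf imf fM]].
have T1 : 1 \in T by case/setIdP: trT.
have sTG := subsetP (NRT_sub trT).
have opT x y : x \in T -> y \in T -> nrt_op K T x y \in T.
  by move=> Tx Ty; have /setIP[] := nrt_op_mem trT Tx Ty.
have opA : {in T & &, forall x y z, nrt_op K T (nrt_op K T x y) z =
    nrt_op K T x (nrt_op K T y z)}.
  have fT x : x \in T -> exists2 a, a \in G / H & x = f a.
    by rewrite -imf => /imsetP.
  move=> _ _ _ /fT[a Ga ->] /fT[b Gb ->] /fT[c Gc ->].
  by rewrite -!fM ?groupM // mulgA.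
have opC x y : x \in T -> y \in T -> K :* nrt_op K T x y = K :* (x * y).
  by move=> Tx Ty; have /setIP[_ /rcoset_eqP] := nrt_op_mem trT Tx Ty.
have opE : {in T &, forall x y, nrt_op K T x y = x * y}.
  move=> x y Tx Ty; apply/eqP; rewrite eq_mulgV1; apply/eqP/set1gP.
  rewrite -coreK1.
  apply/bigcapP=> g Gg; have [z Dz] := NRT_setI_rcoset trT Gg.
  have /setIP[Tz /rcoset_eqP Kz]: z \in T :&: K :* g by rewrite Dz set11.
  have /rcoset_eqP: K :* (g * nrt_op K T x y) = K :* (g * (x * y)).
    rewrite rcosetM -Kz -rcosetM -(opC _ _ Tz (opT _ _ Tx Ty)) -opA //.
    rewrite (opC _ _ (opT _ _ Tz Tx) Ty) rcosetM (opC _ _ Tz Tx) -rcosetM.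
    by rewrite -mulgA rcosetM Kz -rcosetM.
  by rewrite mem_rcoset mem_conjg /conjg !invMg invgK !mulgA.
have grT : group_set T.
  apply/group_setP; split=> // x y Tx Ty; rewrite -opE //.
  exact: opT.
exists (Group grT); split=> //; last first.
- have fm : {in G / H &, {morph f : a b / a * b}}.
    by move=> a b Ga Gb; rewrite fM // opE // -imf imset_f.
  apply/isogP; exists (Morphism fm); first by apply/injmP.
  by rewrite morphimEdom.
- exact: NRT_sub trT.
apply/trivgP/subsetP=> x /setIP[Kx Tx]; rewrite inE.
by apply/eqP/(NRT_rcoset_inj trT) => //; rewrite mulg1.
Qed.

End NormalLeft.

End Transversals.

(** Restates completeness for plain subgroups, so that later arguments need not handle the packed
    vertices. *)
Lemma transiso_complete_isog (gT : finGroupType) (G : {group gT}) d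
    (H K : {group gT}) :
    complete_graph (transiso_graph G d) ->
    H \subset G -> K \subset G -> #|H| = d -> #|K| = d -> H != K ->
  exists S T, [/\ S \in NRT G H, T \in NRT G K & nrt_isog H S K T].
Proof.
move=> cG sHG sKG oH oK neqHK.
have vH : (H \subset G) && (#|H| == d) by rewrite sHG oH eqxx.
have vK : (K \subset G) && (#|K| == d) by rewrite sKG oK eqxx.
have neq : (exist _ H vH : vertex (transiso_graph G d)) != exist _ K vK.
  by rewrite -val_eqE.
by have [_ [S [T]]] := cG _ _ neq; exists S, T.
Qed.

(** * Centers and derived subgroups of p-groups *)

Section PGroups.

Variables (p : nat) (gT : finGroupType) (G : {group gT}).
Hypotheses (p_pr : prime p) (pG : p.-group G).

(** A nontrivial normal subgroup of a nilpotent group meets the center, and one of prime order is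
    then contained in it. *)
Lemma normal_order_p_central (K : {group gT}) :
  K <| G -> #|K| = p -> K \subset 'Z(G).
Proof.
move=> nsKG oK; apply: prime_meetG; first by rewrite oK.
apply: (meet_center_nil (pgroup_nil pG)) => //.
by rewrite -cardG_gt1 oK prime_gt1.
Qed.

Lemma exists_central_order_p (N : {group gT}) :
    N <| G -> N :!=: 1 ->
  exists H : {group gT}, [/\ H \subset N, H \subset 'Z(G) & #|H| = p].
Proof.
move=> nsNG ntN; have ntI := meet_center_nil (pgroup_nil pG) nsNG ntN.
have [|_ dvp _] := @pgroup_pdiv _ p (N :&: 'Z(G)) _ ntI.
  exact: pgroupS (subset_trans (subsetIr _ _) (center_sub G)) pG.
have [x /setIP[Nx Zx] ox] := Cauchy p_pr dvp.
by exists <[x]>%G; rewrite !cycle_subG.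
Qed.

(** If [G] is not abelian, it is the product of ['Z(G)] and [<[x]> <*> <[y]>] for some noncommuting
    [x], [y]. Its derived subgroup is then generated by the central element [[~ x, y]], whose order
    divides [p] because [x ^+ p] is central. *)
Lemma center_index_der1 : #|G : 'Z(G)| <= p ^ 2 -> #|G^`(1)| <= p.
Proof.
move=> leZ; have [cGG | not_cGG] := boolP (abelian G).
  by rewrite (derG1P cGG) cards1 prime_gt0.
have nZG : G \subset 'N('Z(G)) := normal_norm (center_normal G).
have pQ : p.-group (G / 'Z(G)) := quotient_pgroup _ pG.
have ncycQ : ~~ cyclic (G / 'Z(G)).
  by apply: contra not_cGG; apply: cyclic_center_factor_abelian.
have cQQ : abelian (G / 'Z(G)).
  have [n oQ] := p_natP pQ; apply: (p2group_abelian pQ).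
  rewrite oQ pfactorK // -(leq_exp2l _ _ (prime_gt1 p_pr)) -oQ.
  by rewrite card_quotient.
have sG'Z : G^`(1) \subset 'Z(G) by rewrite der1_min.
have [x Gx nZx] : exists2 x, x \in G & x \notin 'Z(G).
  apply/subsetPn; apply: contra not_cGG => sGZ.
  exact: abelianS sGZ (center_abelian G).
have [y Gy ncxy] : exists2 y, y \in G & y \notin 'C[x].
  apply/subsetPn; apply: contra nZx => sGC; rewrite inE Gx.
  by rewrite -sub_cent1.
pose XY := <[x]> <*> <[y]>.
have sXYG : XY \subset G by rewrite join_subG !cycle_subG Gx.
have sZG : 'Z(G) \subset G := center_sub G.
have ltp (A B : {group gT}) :
    B \subset G -> A \subset B -> ~~ (B \subset A) -> p <= #|B : A|.
  move=> sBG sAB; rewrite -indexg_gt1.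
  have: p.-nat #|B : A| := pnat_dvd (dvdn_indexg B A) (pgroupS sBG pG).
  case/p_natP=> [[|k] ->] // _.
  by rewrite expnS leq_pmulr // expn_gt0 prime_gt0.
(* The chain from ['Z(G)] through [<[x]> <*> 'Z(G)] to [XY <*> 'Z(G)] has two proper steps, each of
   index at least [p]; this already exhausts the index of the center. *)
have defG : XY \* 'Z(G) = G.
  have cZXY : 'Z(G) \subset 'C(XY) by rewrite subIset // centS ?orbT.
  rewrite cprodEY //; apply/eqP; rewrite eqEcard join_subG sXYG sZG /=.
  pose A := (<[x]> <*> 'Z(G))%G.
  have sZA : 'Z(G) \subset A := joing_subr _ _.
  have sAXYZ : A \subset XY <*> 'Z(G).
    rewrite join_subG joing_subr andbT.
    by rewrite (subset_trans (joing_subl _ _) (joing_subl _ _)).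
  rewrite -(Lagrange (subset_trans sZA sAXYZ)) -(Lagrange sZG) leq_mul2l.
  rewrite (leq_trans leZ) ?orbT // -(Lagrange_index sAXYZ sZA) leq_mul //.
    apply: ltp => //; first by rewrite join_subG sXYG.
    apply/subsetPn; exists y.
      rewrite (subsetP (joing_subl XY _)) //.
      by rewrite (subsetP (joing_subr _ _)) ?cycle_id.
    apply: contra ncxy; apply: subsetP; rewrite join_subG cycle_subG cent1id /=.
    by rewrite sub_cent1 (subsetP _ x Gx) // centsC subsetIr.
  apply: ltp => //; first by rewrite join_subG cycle_subG Gx.
  by apply/subsetPn; exists x; rewrite // (subsetP (joing_subl _ _)) ?cycle_id.
have Zxy : [~ x, y] \in 'Z(G) by rewrite (subsetP sG'Z) ?mem_commg.
have cxy z : z \in G -> commute z [~ x, y].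
  by move=> Gz; have /centerP[_ cG] := Zxy; apply/commute_sym/cG.
have -> : G^`(1) = <[[~ x, y]]>.
  rewrite -(der_cprod 1 defG) (derG1P (center_abelian G)) cprodg1.
  by apply: der1_joing_cycles; apply: (subsetP (centS sXYG)); case/setIP: Zxy.
(* If the image of [x] had order at least [p ^ 2], it would generate the noncyclic group
   [G / 'Z(G)]. *)
have Zxp : x ^+ p \in 'Z(G).
  have NZx := subsetP nZG x Gx.
  rewrite coset_idr ?groupX // morphX //; apply/eqP; rewrite -order_dvdn.
  have Qx := mem_quotient 'Z(G) Gx.
  have [k ox] := p_natP (mem_p_elt pQ Qx).
  rewrite ox; case: k ox => [|[|k]] ox; rewrite ?dvd1n //.
  case/negP: ncycQ; apply/cyclicP; exists (coset 'Z(G) x).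
  apply/esym/eqP; rewrite eqEcard cycle_subG Qx -orderE ox card_quotient //.
  by rewrite (leq_trans leZ) // leq_exp2l // prime_gt1.
rewrite -orderE dvdn_leq ?prime_gt0 // order_dvdn -commXg; last exact: cxy.
by apply/commgP; case/centerP: Zxp => _ /(_ y Gy).
Qed.
End PGroups.

Lemma card_quotient_der1 (gT : finGroupType) (G H : {group gT}) : H <| G ->
  (#|(G / H)^`(1)| * #|G^`(1) :&: H|)%N = #|G^`(1)|.
Proof.
move=> nsHG; have nHG := normal_norm nsHG.
rewrite -quotient_der // card_quotient ?(subset_trans (der_sub 1 G)) //.
by rewrite mulnC LagrangeI.
Qed.

(** By the classification of nonabelian p-groups with a cyclic maximal subgroup, odd order leaves
    only the modular groups, whose derived subgroup has prime order. *)
Lemma cyclic_maximal_der1 (p : nat) (gT : finGroupType) (G X : {group gT}) :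
    p.-group G -> odd #|G| -> cyclic X -> X \subset G -> #|G : X| = p ->
  #|G^`(1)| <= p.
Proof.
move=> pG oddG cycX sXG iXG.
have [cGG | not_cGG] := boolP (abelian G).
  by rewrite (derG1P cGG) cards1 -iXG indexg_gt0.
have := maximal_cycle_extremal pG not_cGG cycX sXG iXG.
rewrite (negPf (odd_not_extremal2 oddG)) andbF orbF => /eqP.
case/modular_group_classP=> q q_pr [n n_gt23 isoG].
have n_gt2 : 2 < n := leq_trans (leq_addl _ _) n_gt23.
have [[x y] genG modG] := generators_modular_group q_pr n_gt2 isoG.
have [_ _ [_ oG' _] _ _] := modular_group_structure q_pr n_gt2 genG isoG modG.
have := pgroupP pG q q_pr; rewrite -oG' cardSg ?der_sub // => /(_ isT)/eqP->.
exact: leqnn.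
Qed.

(** * Consequences of completeness in order p^5 *)

Section Proposition.

Variables (p : nat) (gT : finGroupType) (G : {group gT}).
Hypotheses (p_pr : prime p) (p_odd : odd p) (oG : #|G| = (p ^ 5)%N).
Hypotheses (oPhi : #|'Phi(G)| = (p ^ 3)%N)
  (cG : complete_graph (transiso_graph G p)).
Variable K : {group gT}.
Hypotheses (sKG : K \subset G) (oK : #|K| = p) (nZK : ~~ (K \subset 'Z(G))).

Let p_gt0 : 0 < p. Proof. exact: prime_gt0. Qed.
Let p_gt1 : 1 < p. Proof. exact: prime_gt1. Qed.
Let pG : p.-group G. Proof. by rewrite /pgroup oG pnatX pnat_id. Qed.
Let oddG : odd #|G|. Proof. by rewrite oG oddX p_odd orbT. Qed.

Let not_cGG : ~~ abelian G.
Proof. by apply: contra nZK => /center_idP->. Qed.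

Let central_normal (H : {group gT}) : H \subset 'Z(G) -> H <| G.
Proof. exact: sub_center_normal. Qed.

Lemma central_quotient_complement (H L : {group gT}) :
    H \subset 'Z(G) -> #|H| = p ->
    L \subset G -> #|L| = p -> ~~ (L \subset 'Z(G)) ->
  exists M : {group gT}, [/\ M \subset G, L :&: M = 1, #|M| = (p ^ 4)%N
    & G / H \isog M].
Proof.
move=> sHZ oH sLG oL nZL; have nsHG := central_normal sHZ.
have neqHL : H != L by apply: contraNneq nZL => <-.
have [S [T [trS trT ST]]] :=
  transiso_complete_isog cG (normal_sub nsHG) sLG oH oL neqHL.
have [|M [_ tiLM sMG isoM]] := nrt_isog_core1 nsHG trS trT _ ST.
  (* A nontrivial core would be all of [L], since [L] has prime order; [L] would then be normal,
     hence central. *)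
  apply/eqP; apply: contraNT nZL => ntC.
  have sLC : L \subset gcore L G.
    apply: prime_meetG; first by rewrite oL.
    by rewrite setIC (setIidPl (gcore_sub L G)).
  apply: (normal_order_p_central p_pr pG _ oL).
  have -> : L :=: gcore L G by apply/eqP; rewrite eqEsubset sLC gcore_sub.
  exact: gcore_normal.
exists M; split=> //; rewrite -(card_isog isoM) -divg_normal // oG oH.
by rewrite expnS mulKn.
Qed.

Lemma central_quotients_isog (H1 H2 : {group gT}) :
    H1 \subset 'Z(G) -> H2 \subset 'Z(G) -> #|H1| = p -> #|H2| = p ->
  G / H1 \isog G / H2.
Proof.
move=> sH1Z sH2Z oH1 oH2; have [-> | neqH] := eqVneq H1 H2.
  exact: isog_refl.
have [ns1 ns2] := (central_normal sH1Z, central_normal sH2Z).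
have [S [T [trS trT ST]]] :=
  transiso_complete_isog cG (normal_sub ns1) (normal_sub ns2) oH1 oH2 neqH.
exact: nrt_isog_normal ns1 trS trT ns2 ST.
Qed.

Lemma Phi_sub_p4 (M : {group gT}) :
  M \subset G -> #|M| = (p ^ 4)%N -> 'Phi(G) \subset M.
Proof.
move=> sMG oM; apply: Phi_sub_max; apply: p_index_maximal => //.
by rewrite -divgS // oG oM expnS mulnK ?expn_gt0 ?p_gt0.
Qed.

Let exists_central (N : {group gT}) : N <| G -> N :!=: 1 ->
  exists H : {group gT}, [/\ H \subset N, H \subset 'Z(G) & #|H| = p].
Proof. exact: exists_central_order_p. Qed.

(** A noncentral [L] would have a complement of order [p ^ 4], which contains ['Phi(G)] and hence
    [L]. *)
Lemma Phi_order_p_central (L : {group gT}) :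
  L \subset 'Phi(G) -> #|L| = p -> L \subset 'Z(G).
Proof.
move=> sLPhi oL; apply: contraT => nZL.
have sLG := subset_trans sLPhi (Phi_sub G).
have [|H [_ sHZ oH]] := exists_central (normal_refl G).
  by apply: contraNneq not_cGG => ->; apply: abelian1.
have [M [sMG tiLM oM _]] := central_quotient_complement sHZ oH sLG oL nZL.
have:= p_gt1; rewrite -oL -(setIidPl (subset_trans sLPhi (Phi_sub_p4 sMG oM))).
by rewrite tiLM cards1.
Qed.

Let ntG' : G^`(1)%G :!=: 1.
Proof. by apply: contra not_cGG => /eqP/derG1P. Qed.

(** Comparison with a central [H0] of order [p] inside the derived subgroup: the quotients by [H]
    and [H0] are isomorphic, so [H] and [H0] meet the derived subgroup in the same order. *)
Lemma central_order_p_sub_der1 (H : {group gT}) :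
  H \subset 'Z(G) -> #|H| = p -> H \subset G^`(1).
Proof.
move=> sHZ oH.
have [H0 [sH0G' sH0Z oH0]] := exists_central (der_normal 1 G) ntG'.
apply: prime_meetG; first by rewrite oH.
apply/negP=> /eqP tiHG'.
have /(isog_der 1)/card_isog eqG' := central_quotients_isog sHZ sH0Z oH oH0.
have := card_quotient_der1 (central_normal sHZ).
rewrite -(card_quotient_der1 (central_normal sH0Z)) eqG' => /eqP.
rewrite eqn_pmul2l ?cardG_gt0 // setIC tiHG' (setIidPr sH0G') oH0 cards1.
by rewrite eq_sym gtn_eqF.
Qed.

Lemma central_order_p_card_der1 (H M : {group gT}) :
    H \subset 'Z(G) -> #|H| = p -> G / H \isog M -> #|M^`(1)| <= p ->
  #|G^`(1)| <= p ^ 2.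
Proof.
move=> sHZ oH /(isog_der 1)/card_isog oM' leM'.
rewrite -(card_quotient_der1 (central_normal sHZ)) oM' -mulnn leq_mul //.
by rewrite -oH subset_leq_card ?subsetIr.
Qed.

(** * Excluding a noncyclic Frattini subgroup *)

Lemma cyclic_Phi : cyclic 'Phi(G).
Proof.
have pPhi : p.-group 'Phi(G) := pgroupS (Phi_sub G) pG.
rewrite (odd_pgroup_rank1_cyclic pPhi); last first.
  exact: oddSg (Phi_sub G) oddG.
(* In odd order, failure of cyclicity means rank at least 2, which provides [E]. *)
rewrite leqNgt; apply/negP=> /p_rank_geP[E /pnElemP[sEPhi abelE logE]].
have pE := abelem_pgroup abelE.
have oE : #|E| = (p ^ 2)%N by rewrite (card_pgroup pE) logE.
have order_p x : x \in E -> x != 1 ->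
    <[x]>%G \subset 'Z(G) /\ #|<[x]>%G| = p.
  move=> Ex ntx; have ox := abelem_order_p abelE Ex ntx.
  split=> //; apply: Phi_order_p_central => //.
  by rewrite cycle_subG (subsetP sEPhi).
have sEZ : E \subset 'Z(G).
  apply/subsetP=> x Ex; have [-> | ntx] := eqVneq x 1; first exact: group1.
  by rewrite -cycle_subG; case: (order_p x Ex ntx).
have sEG' : E \subset G^`(1).
  apply/subsetP=> x Ex; have [-> | ntx] := eqVneq x 1; first exact: group1.
  rewrite -cycle_subG; case: (order_p x Ex ntx).
  exact: central_order_p_sub_der1.
have /trivgPn[x Ex ntx] : E :!=: 1 by rewrite -cardG_gt1 oE (ltn_exp2l 0).
have [sHZ oH] := order_p x Ex ntx.
have [M [sMG tiKM oM isoM]] := central_quotient_complement sHZ oH sKG oK nZK.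
have sEZM : E \subset 'Z(M).
  rewrite subsetI (subset_trans sEPhi (Phi_sub_p4 sMG oM)).
  by rewrite (subset_trans sEZ) // (subset_trans (subsetIr _ _)) ?centS.
have leM' : #|M^`(1)| <= p.
  apply: (center_index_der1 p_pr (pgroupS sMG pG)).
  rewrite -(leq_pmul2l (cardG_gt0 'Z(M))) Lagrange ?center_sub // oM.
  by rewrite (@expnD p 2 2) leq_mul2r -oE subset_leq_card ?orbT.
have defG' : E :=: G^`(1).
  by apply/eqP; rewrite eqEcard sEG' oE (central_order_p_card_der1 sHZ oH isoM).
(* ['Phi(G)] is generated by the derived subgroup [E] and the p-th powers; the latter are central
   because [[~ u ^+ p, v] = [~ u, v] ^+ p] and [E] is central of exponent [p]. *)
have sPhiZ : 'Phi(G) \subset 'Z(G).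
  have sG'Z : G^`(1) \subset 'Z(G) by rewrite -defG'.
  rewrite (Phi_joing pG) join_subG sG'Z (MhoE 1 pG) gen_subG.
  apply/subsetP=> _ /imsetP[u Gu ->]; apply/centerP; rewrite groupX //.
  split=> // v Gv; apply/commgP; rewrite expn1 commXg.
    have : [~ u, v] \in E by rewrite defG' mem_commg.
    by case/(abelemP p_pr): abelE => _ expE /expE->.
  have /(subsetP sG'Z)/centerP[_ cuv] : [~ u, v] \in G^`(1).
    by rewrite mem_commg.
  exact/commute_sym/cuv.
have : #|G^`(1)| <= p.
  apply: (center_index_der1 p_pr pG).
  rewrite (leq_trans (dvdn_leq _ (indexgS G sPhiZ))) //.
  by rewrite -divgS ?Phi_sub // oG oPhi -expnB.
by rewrite -defG' oE leqNgt (ltn_exp2l 1).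
Qed.

(** * Excluding a cyclic Frattini subgroup *)

Lemma complete_noncentral_False : False.
Proof.
have [||H [sHPhi sHZ oH]] := @exists_central 'Phi(G)%G.
- exact: Phi_normal.
- by rewrite -cardG_gt1 oPhi (ltn_exp2l 0).
have [M [sMG tiKM oM isoM]] := central_quotient_complement sHZ oH sKG oK nZK.
have sPhiM := Phi_sub_p4 sMG oM; have pM := pgroupS sMG pG.
have iM : #|G : M| = p by rewrite -divgS // oG oM expnS mulnK ?expn_gt0 ?p_gt0.
have leG' : #|G^`(1)| <= p ^ 2.
  apply: (central_order_p_card_der1 sHZ oH isoM).
  apply: (cyclic_maximal_der1 pM (oddSg sMG oddG) cyclic_Phi sPhiM).
  by rewrite -divgS // oM oPhi expnS mulnK ?expn_gt0 ?p_gt0.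
have oPhiM : #|'Phi(M)| = (p ^ 2)%N.
  have nsHG := central_normal sHZ.
  rewrite -(card_isog (isog_Phi isoM)) /= -(quotient_Phi pG (normal_norm nsHG)).
  by rewrite -divg_normal ?(normalS _ (Phi_sub G)) // oPhi oH expnS mulKn.
have nPhiMG : G \subset 'N('Phi(M)).
  have nsMG : M <| G.
    by apply: (p_maximal_normal pG); apply: p_index_maximal; rewrite ?iM.
  exact: char_norm_trans (Phi_char M) (normal_norm nsMG).
(* Inclusion between subgroups of the cyclic group ['Phi(G)] reduces to divisibility of orders, here
   powers [p ^ a] and [p ^ b] with [a <= 2 <= b]. *)
have sG'PhiM : G^`(1) \subset 'Phi(M).
  apply: subset_trans (PhiS pM sPhiM).
  have pF := pgroupS (Phi_sub G) pG.
  have [a oG'] := p_natP (pgroupS (der_sub 1 G) pG).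
  have [b oPP] := p_natP (pgroupS (Phi_sub 'Phi(G)) pF).
  have sG'F : G^`(1) \subset 'Phi(G) by rewrite (Phi_joing pG) joing_subl.
  rewrite -(cardSg_cyclic cyclic_Phi sG'F (Phi_sub _)) oG' oPP dvdn_exp2l //.
  have le_a2 : a <= 2 by rewrite -(leq_exp2l _ _ p_gt1) -oG'.
  apply: leq_trans le_a2 _.
  (* The quotient of ['Phi(G)] by its own Frattini subgroup is cyclic and elementary abelian, so its
     order [p ^ (3 - b)] is at most [p]; this excludes [b = 0] and [b = 1]. *)
  have := abelem_cyclic (Phi_quotient_abelem pF).
  rewrite quotient_cyclic ?cyclic_Phi // => /esym.
  rewrite card_quotient ?gFnorm // -divgS ?Phi_sub // oPhi oPP.
  case: b {oPP} => [|[|b]] //; first by rewrite divn1 pfactorK.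
  by rewrite -expnB // pfactorK.
have cQ : abelian (G / 'Phi(M)) by rewrite sub_der1_abelian.
have defG : M * K = G.
  apply/eqP; rewrite eqEcard mul_subG //= TI_cardMg; last by rewrite setIC.
  by rewrite oM oK oG -expnSr.
(* By minimality of the Frattini subgroup it suffices that [G / 'Phi(M)] is elementary abelian; it
   is a central product of the elementary abelian images of [M] and [K]. *)
have : 'Phi(G) \subset 'Phi(M).
  apply: (Phi_min pG nPhiMG).
  have defQ : (M / 'Phi(M)) \* (K / 'Phi(M)) = G / 'Phi(M).
    rewrite cprodE; first by rewrite -quotientMl ?gFnorm // defG.
    by rewrite (sub_abelian_cent2 cQ) ?quotientS.
  rewrite (cprod_abelem p defQ) (Phi_quotient_abelem pM) quotient_abelem //.
  by rewrite -oK prime_abelem ?oK.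
by move/subset_leq_card; rewrite oPhi oPhiM leq_exp2l.
Qed.

End Proposition.

Theorem proposition3p13 (p : nat) (gT : finGroupType) (G : {group gT})
    (p_prime : prime p) (p_odd : odd p) (oG : #|G| = (p ^ 5)%N)
    (G_not_pcentral : not_p_central p G) (oPhi : #|'Phi(G)%g| = (p ^ 3)%N) :
  ~ complete_graph (transiso_graph G p).
Proof.
move=> cG; case: G_not_pcentral => K [sKG oK nZK].
exact: (complete_noncentral_False p_prime p_odd oG oPhi cG sKG oK nZK).
Qed.
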